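(* Let $L$ be a countable frame. If $\mathrm{pt}(L)$, the spectrum of $L$, is a $T_1$ space, then $L$ is finite.
   Context: A frame is a complete lattice in which finite infima distribute over arbitrary suprema. The spectrum $\mathrm{pt}(L)$ of a frame $L$ is the set of prime elements of $L$ (elements $p\neq\top$ such that $a\wedge b\leq p$ implies $a\leq p$ or $b\leq p$) with the hull-kernel topology, whose open sets are the sets $\{p\in\mathrm{pt}(L)\mid x\not\leq p\}$, $x\in L$. *)

(* Defs.v *)
From HB Require Import structures.
From mathcomp Require Import all_boot all_order.
From mathcomp Require Import boolp classical_sets functions cardinality.
From mathcomp Require Import topology.

Set Implicit Arguments.
Unset Strict Implicit.
Unset Printing Implicit Defensive.

Import Order.TTheory.
Local Open Scope classical_set_scope.
Local Open Scope order_scope.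

(* Only suprema are taken as primitive: arbitrary infima then exist, see       *)
(* [infimums_neq0]. The one-element lattice is allowed.                        *)
HB.mixin Record TBLattice_isComplete d (L : Type) of Order.TBLattice d L := {
  lsup : set L -> L;
  supremums_lsup : forall A : set L, supremums A (lsup A)
}.

#[short(type="completeLatticeType")]
HB.structure Definition CompleteLattice d :=
  {L of Order.TBLattice d L & TBLattice_isComplete d L}.

HB.mixin Record CompleteLattice_isFrame d (L : Type)
    of CompleteLattice d L := {
  meet_lsupr : forall (x : L) (A : set L),
    Order.meet x (lsup A) = lsup [set Order.meet x a | a in A]
}.

#[short(type="frameType")]
HB.structure Definition Frame d :=
  {L of CompleteLattice d L & CompleteLattice_isFrame d L}.

Section CompleteLatticeTheory.
Context {d : Order.disp_t} {L : completeLatticeType d}.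
Implicit Types (x y : L) (A : set L).

Lemma lsup_ub A x : A x -> x <= lsup A.
Proof. by case: (supremums_lsup A) => ub _ Ax; exact: ub. Qed.

Lemma lsup_le A x : (forall a, A a -> a <= x) -> lsup A <= x.
Proof. by case: (supremums_lsup A) => _ lub Ax; exact: lub. Qed.

Lemma infimums_neq0 A : infimums A !=set0.
Proof.
exists (lsup (lbound A)); split=> [a Aa|x]; last exact: lsup_ub.
by apply: lsup_le => x; apply.
Qed.

End CompleteLatticeTheory.

Section Spectrum.
Context {d : Order.disp_t} (L : frameType d).

Definition prime_elements : set L := [set p | p <> \top /\
  forall a b : L, Order.meet a b <= p -> a <= p \/ b <= p].

Definition pt : Type := set_type prime_elements.

HB.instance Definition _ := Choice.on pt.

Definition pt_val (p : pt) : L := val p.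

Lemma pt_valP (p : pt) : prime_elements (pt_val p).
Proof. by have := valP p; rewrite inE. Qed.

Definition hull_open (x : L) : set pt := [set p | ~ (x <= pt_val p)].

Let hk_open (U : set pt) : Prop := exists x : L, U = hull_open x.

Let hk_openT : hk_open setT.
Proof.
exists \top; apply/seteqP; split=> // p _; rewrite /hull_open /= le1x => /eqP.
by case: (pt_valP p).
Qed.

Let hk_openI : setI_closed hk_open.
Proof.
move=> _ _ [x ->] [y ->]; exists (Order.meet x y).
apply/seteqP; split=> p /=.
  by move=> [xp yp] /(proj2 (pt_valP p)) [].
by move=> xyp; split=> le_p; apply: xyp; [exact: leIxl | exact: leIxr].
Qed.

Let hk_open_bigU (I : Type) (f : I -> set pt) :
  (forall i, hk_open (f i)) -> hk_open (\bigcup_i f i).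
Proof.
move=> /choice[x fE]; exists (lsup (range x)).
apply/seteqP; split=> p /=.
  move=> [i _]; rewrite fE => xip le_p; apply: xip.
  by apply: le_trans le_p; apply: lsup_ub; exists i.
move=> nle; apply: contrapT => nU; apply: nle; apply: lsup_le => _ [i _ <-].
by apply: contrapT => xip; apply: nU; exists i => //; rewrite fE.
Qed.

HB.instance Definition _ :=
  isOpenTopological.Build pt hk_openT hk_openI hk_open_bigU.

Lemma pt_openE (U : set pt) : open U <-> exists x : L, U = hull_open x.
Proof. by []. Qed.

End Spectrum.

(* Main.v *)
Require Import Defs.
From mathcomp Require Import all_boot all_order.
From mathcomp Require Import boolp classical_sets functions cardinality.
From mathcomp Require Import topology.

Local Open Scope classical_set_scope.

(** Two facts about a countable frame [L] carry the proof; both come from a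
    Cantor diagonal argument, the suprema of [L] providing the element that
    escapes the enumeration.

    First, [L] has enough primes ([prime_separation]).  Were an interval of [L]
    dense in itself, nested subintervals avoiding the elements of [L] one after
    the other could be chosen in it, and the supremum of their lower ends would
    be a new element.  So every nontrivial interval contains a covering pair
    [x < y], and in a frame the largest [z] with [z /\ y <= x] is then prime.

    Second, if [pt L] is T1, that is, if distinct primes are incomparable, then
    [L] satisfies the ascending chain condition ([no_strict_chain]).  Given
    [a 0 < a 1 < ...], separation yields primes [p n] above [a n] but not above
    [a n.+1].  The points [p 0, p 1, ...] form a discrete subspace: [a n.+1]
    defines an open set containing only [p 0, ..., p n] among them, and by T1
    the finitely many points [p 0, ..., p n.-1] can be removed from it.  Unions
    of the resulting open sets cut out every set of indices, so [L] would be
    uncountable.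

    The theorem follows by Noetherian induction on the finiteness of the set of
    elements above [x].  If [x] is prime, this set is [{x, \top}]: an element
    strictly between would lie below a second prime comparable to [x].
    Otherwise [a /\ b <= x] with neither [a] nor [b] below [x], and by
    distributivity every [y] above [x] is the meet of [y \/ a] and [y \/ b],
    which range over the finite sets of elements above [x \/ a] and
    [x \/ b]. *)

Set Implicit Arguments.
Unset Strict Implicit.
Unset Printing Implicit Defensive.

Import Order.TTheory.
Local Open Scope order_scope.

Section Frames.
Context {d : Order.disp_t} {L : frameType d}.
Implicit Types (x y z p : L).

Lemma meet_join_le x y u v : y `&` u <= x -> y `&` v <= x -> y `&` (u `|` v) <= x.
Proof.
move=> yux yvx.
have uvS : u `|` v <= lsup [set u; v].
  by rewrite leUx; apply/andP; split; apply: lsup_ub; [left|right].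
apply: (le_trans (leI2 (lexx y) uvS)); rewrite meet_lsupr.
by apply: lsup_le => _ [w [->|->] <-].
Qed.

Lemma meet_joins_le x u v : u `&` v <= x -> (x `|` u) `&` (x `|` v) <= x.
Proof.
move=> uvx; apply: meet_join_le; first exact: leIr.
by rewrite meetC; apply: meet_join_le; [exact: leIr | rewrite meetC].
Qed.

Lemma prime_meets_le p (q : nat -> L) n : prime_elements p ->
  \meet_(i < n) q i <= p -> exists2 i, (i < n)%N & q i <= p.
Proof.
move=> [pT pP]; elim: n => [|n IHn].
  by rewrite big_ord0 le1x => /eqP.
rewrite big_ord_recr /= => /pP[/IHn[i ltin qip]|qnp].
  by exists i => //; exact: ltnW.
by exists n.
Qed.

(** The prime is the Heyting implication from [y] to [x].  It is prime because
    [y /\ u], once not below [x], joins with [x] to the whole of [y], so that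
    [y /\ u /\ v <= x] forces [y /\ v <= x]. *)
Lemma cover_prime x y : x < y -> (forall z, x < z -> z < y -> False) ->
  exists p, [/\ prime_elements p, x <= p & ~ y <= p].
Proof.
move=> ltxy cover; pose p := lsup [set z | y `&` z <= x].
have le_pE z : z <= p <-> y `&` z <= x.
  split=> [lezp|]; last by move=> yzx; exact: lsup_ub.
  apply: (le_trans (leI2 (lexx y) lezp)); rewrite meet_lsupr.
  by apply: lsup_le => _ [w wx <-].
have Nyp : ~ y <= p by rewrite le_pE meetxx => /(lt_le_trans ltxy); rewrite ltxx.
exists p; split=> //; last by apply/le_pE; exact: leIr.
split=> [pT|u v]; first by apply: Nyp; rewrite pT lex1.
rewrite !le_pE => yuvx; apply: contrapT => /not_orP[Nu Nv].
have yE : x `|` (y `&` u) = y.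
  apply/eqP; apply: contrapT => /negP ney.
  apply: (cover (x `|` (y `&` u))).
    rewrite lt_neqAle leUl andbT; apply/eqP => xE; apply: Nu.
    by rewrite [leRHS]xE leUr.
  by rewrite lt_neqAle ney leUx (ltW ltxy) leIl.
apply: Nv; rewrite -[in leLHS]yE meetC.
apply: meet_join_le; first exact: leIr.
by rewrite meetC -meetA.
Qed.

Section Enumerated.
Variables (e : nat -> L) (eP : forall x, exists n, e n = x).

(** In an interval without covers, two elements strictly inside a subinterval
    cut off two disjoint pieces of it, and any given element misses one of
    them.  Iterating against [e] yields nested intervals, and the supremum of
    their lower ends lies in all of them, so it is no value of [e]. *)
Lemma interval_cover a b : b < a ->
  exists x y, [/\ b <= x, x < y, y <= a & forall z, x < z -> z < y -> False].
Proof.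
move=> ltba; apply: contrapT => Ncover.
have dense x y : b <= x -> x < y -> y <= a -> exists2 z, x < z & z < y.
  move=> bx xy ya; apply: contrapT => Nz; apply: Ncover; exists x, y.
  by split=> // z xz zy; apply: Nz; exists z.
pose good (I : L * L) := [/\ b <= I.1, I.1 < I.2 & I.2 <= a].
pose next (Ic : (L * L) * L) (J : L * L) := good Ic.1 ->
  [/\ good J, Ic.1.1 <= J.1, J.2 <= Ic.1.2 & ~ (J.1 <= Ic.2 /\ Ic.2 <= J.2)].
have [Ic|step stepP] := @choice _ _ next.
  case: Ic => -[x y] c; have [[/= bx xy ya]|Ng] := pselect (good (x, y)); last by exists (x, y).
  have [z xz zy] := dense _ _ bx xy ya.
  have [w zw wy] := dense _ _ (le_trans bx (ltW xz)) zy ya.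
  have [cz|Ncz] := pselect (c <= z).
    exists (w, y) => _; split=> /=; [split=> //=| |by []|].
    - exact: le_trans bx (ltW (lt_trans xz zw)).
    - exact: ltW (lt_trans xz zw).
    - by move=> [wc _]; have := lt_le_trans zw (le_trans wc cz); rewrite ltxx.
  exists (x, z) => _; split=> /=; [split=> //=|by []|exact: ltW|by case].
  exact: le_trans (ltW zy) ya.
pose I := fix I n := if n is m.+1 then step (I m, e m) else (b, a).
have Igood n : good (I n).
  by elim: n => [|n IHn] /=; [split=> //=|have [] := stepP (I n, e n) IHn].
have IS n : [/\ (I n).1 <= (I n.+1).1, (I n.+1).2 <= (I n).2 &
    ~ ((I n.+1).1 <= e n /\ e n <= (I n.+1).2)].
  by have [_] := stepP (I n, e n) (Igood n).
have lo_homo : {homo (fun n => (I n).1) : m n / (m <= n)%N >-> m <= n}.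
  by apply: homo_leq => [x|x y z|n]; [exact: lexx|exact: le_trans|case: (IS n)].
have hi_homo : {homo (fun n => (I n).2) : m n / (m <= n)%N >-> n <= m}.
  apply: homo_leq => [x|y x z yx zy|n]; [exact: lexx|exact: le_trans zy yx|].
  by case: (IS n).
have lo_hi m n : (I m).1 <= (I n).2.
  apply: (le_trans (lo_homo _ _ (leq_maxl m n))).
  apply: le_trans (hi_homo _ _ (leq_maxr m n)).
  by apply: ltW; case: (Igood (maxn m n)).
have [n en] := eP (lsup (range (fun m => (I m).1))).
have [_ _] := IS n; apply; rewrite en; split.
  by apply: lsup_ub; exists n.+1.
by apply: lsup_le => _ [m _ <-].
Qed.

(** In other words, [L] is spatial. *)
Lemma prime_separation a b : ~ a <= b ->
  exists p, [/\ prime_elements p, b <= p & ~ a <= p].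
Proof.
move=> Nab.
have lt_ab : a `&` b < a.
  by rewrite lt_neqAle leIl andbT; apply/eqP => abE; apply: Nab; rewrite -abE leIr.
have [x [y [abx xy ya cover]]] := interval_cover lt_ab.
have [p [pP xp Nyp]] := cover_prime xy cover.
have Nap : ~ a <= p by move=> /(le_trans ya).
by exists p; split=> //; case: (pP.2 _ _ (le_trans abx xp)).
Qed.

Hypothesis prime_antichain :
  forall p q, prime_elements p -> prime_elements q -> p <= q -> p = q.

(** Within the points [p n], the open set given by [v n] contains [p n] only:
    [a n.+1] excludes the later points and the meet excludes the earlier ones,
    which are not below [p n] by incomparability. *)
Lemma no_strict_chain (a : nat -> L) : ~ forall n, a n < a n.+1.
Proof.
move=> aS.
have a_homo : {homo a : m n / (m <= n)%N >-> m <= n}.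
  by apply: homo_leq => [x|x y z|n]; [exact: lexx|exact: le_trans|exact: ltW].
have [n|p pP] := choice (P := fun n p =>
    [/\ prime_elements p, a n <= p & ~ a n.+1 <= p]).
  by apply: prime_separation => /(lt_le_trans (aS n)); rewrite ltxx.
pose v n := a n.+1 `&` \meet_(i < n) p i.
have v_le m n : m <> n -> v m <= p n.
  move=> /eqP; rewrite neq_ltn => /orP[ltmn|ltnm].
    by apply: leIxl; have [_ anp _] := pP n; exact: le_trans (a_homo _ _ ltmn) anp.
  by apply: leIxr; exact: (@meets_inf _ _ _ (Ordinal ltnm) xpredT (fun i => p i)).
have v_nle n : ~ v n <= p n.
  have [pn an Nan] := pP n => /(proj2 pn)[//|/(prime_meets_le pn)[i ltin pip]].
  have [pi _] := pP i; rewrite (prime_antichain pi pn pip); apply.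
  exact: le_trans (a_homo _ _ ltin) an.
(* [k] enumerates [u] itself, so [u <= p k] is equivalent to its negation *)
pose u := lsup [set v n | n in [set n | e n <= p n]].
have [k ek] := eP u.
have [uk|Nuk] := pselect (u <= p k).
  by apply: (v_nle k); apply: le_trans (uk); apply: lsup_ub; exists k; rewrite /= ?ek.
apply: (Nuk); apply: lsup_le => _ [n /= en <-].
by apply: v_le => nk; apply: Nuk; rewrite -ek -nk.
Qed.

(** An element with infinitely many elements above it would have a strictly
    larger one with the same property, hence start a strict chain. *)
Lemma finite_upset x : finite_set [set y | x <= y].
Proof.
apply: contrapT => bad_x.
pose bad z := ~ finite_set [set y | z <= y].
have bad_up z : bad z -> exists2 w, z < w & bad w.
  move=> bad_z; apply: contrapT => Nw.
  have fin_up c : ~ c <= z -> finite_set [set y | z `|` c <= y].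
    move=> Ncz; apply: contrapT => bad_c; apply: Nw; exists (z `|` c) => //.
    rewrite lt_neqAle leUl andbT; apply/eqP => zE; apply: Ncz.
    by rewrite [leRHS]zE leUr.
  apply: bad_z; have [zP|NzP] := pselect (prime_elements z).
    apply: sub_finite_set (finite_set2 z \top) => y zy.
    have [->|/eqP yT] := eqVneq y \top; [by right|left].
    have [|q [qP yq _]] := @prime_separation \top y.
      by rewrite le1x => /eqP.
    apply/eqP; rewrite eq_le zy andbT.
    by rewrite (prime_antichain zP qP (le_trans zy yq)).
  have [zT|NzT] := pselect (z = \top).
    apply: sub_finite_set (finite_set1 \top) => y /=.
    by rewrite zT le1x => /eqP.
  have [a [b [abz Naz Nbz]]] : exists a b, [/\ a `&` b <= z, ~ a <= z & ~ b <= z].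
    apply: contrapT => Nab; apply: NzP; split=> // a b abz.
    by apply: contrapT => /not_orP[Na Nb]; apply: Nab; exists a, b.
  apply: sub_finite_set
    (finite_image2 (fun s t => s `&` t) (fin_up a Naz) (fin_up b Nbz)) => y /= zy.
  exists (y `|` a); first exact: leU2.
  exists (y `|` b); first exact: leU2.
  apply: le_anti; rewrite lexI !leUl !andbT.
  exact: meet_joins_le (le_trans abz zy).
have [z|up upP] := choice (P := fun z w => bad z -> z < w /\ bad w).
  have [/bad_up[w zw bw]|Nz] := pselect (bad z); first by exists w.
  by exists z.
have chain_bad n : bad (iter n up x).
  by elim: n => //= n /upP[].
by apply: (@no_strict_chain (fun n => iter n up x)) => n; case: (upP _ (chain_bad n)).
Qed.

End Enumerated.

(** The closure of a point of [pt L] consists of the primes above it. *)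
Lemma accessible_prime_antichain : accessible_space (pt L) ->
  forall p q, prime_elements p -> prime_elements q -> p <= q -> p = q.
Proof.
move=> T1 p q pP qP pq; apply: contrapT => /eqP Npq.
pose P : pt L := SigSub (mem_set pP); pose Q : pt L := SigSub (mem_set qP).
have [|U [/pt_openE[x ->]]] := T1 Q P.
  by apply: contra Npq => /eqP QP; apply/eqP; exact: (esym (congr1 (@pt_val _ L) QP)).
rewrite !inE /= => Nxq /contrapT xp; apply: Nxq.
exact: le_trans xp pq.
Qed.

Lemma countable_enumeration : countable [set: L] ->
  exists e : nat -> L, forall x, exists n, e n = x.
Proof.
move=> /pfcard_geP[L0|]; first by have : [set: L] \bot by []; rewrite L0.
move=> /unsquash f; exists f => x.
by have [n _ fn] := @surj _ _ _ _ f x I; exists n.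
Qed.

End Frames.

Local Close Scope order_scope.

Theorem corollary3p4 (d : Order.disp_t) (L : frameType d) :
  countable [set: L] -> accessible_space (pt L) -> finite_set [set: L].
Proof.
move=> /countable_enumeration[e eP] /accessible_prime_antichain antichain.
apply: sub_finite_set (finite_upset eP antichain \bot%O) => x _.
exact: le0x.
Qed.
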